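(* Let $K$ be a field and let $I\subset K[x,y]$ be a convex monomial ideal of height $2$. Then $I^k$ is convex for all $k\ge1$.
   Context: For a monomial ideal $I\subset K[x,y]$ of height $2$, $G(I)=\{u_1,\ldots,u_m\}$ is its unique minimal set of monomial generators, labeled so that $u_1>\cdots>u_m$ lexicographically (with $x>y$). Writing $u_i=x^{a_i}y^{b_i}$, one has $a_1>\cdots>a_m=0$ and $0=b_1<\cdots<b_m$. The exponent vector of $u_i$ is $\mathbf c_i=(a_i,b_i)$. For integer vectors $\le$ is componentwise. The ideal $I$ is convex if $2\mathbf c_i\le\mathbf c_{i-1}+\mathbf c_{i+1}$ for $i=2,\ldots,m-1$. *)

(* Defs.v *)
From mathcomp Require Import all_boot all_order all_algebra.
From mathcomp Require Import classical_sets.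
From mathcomp Require Import mpoly.

Set Implicit Arguments.
Unset Strict Implicit.
Unset Printing Implicit Defensive.

Import GRing.Theory.

Local Open Scope classical_set_scope.
Local Open Scope ring_scope.

Section Ideals.
Variable R : comNzRingType.
Implicit Types I P S : set R.

(* The [idealr_closed] predicate of ring_quotient is boolean and forces ideals
   to be proper, hence this definition. *)
Definition is_ideal I : Prop :=
  [/\ I 0, forall p q, I p -> I q -> I (p + q) & forall p q, I q -> I (p * q)].

Definition is_prime_ideal P : Prop :=
  [/\ is_ideal P, ~ P 1 & forall p q, P (p * q) -> P p \/ P q].

Definition ideal_span S : set R :=
  [set p | exists n (c f : 'I_n -> R),
     (forall i, S (f i)) /\ p = \sum_(i < n) c i * f i].

Definition ideal_pow I (k : nat) : set R :=
  ideal_span [set p | exists f : 'I_k -> R,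
     (forall i, I (f i)) /\ p = \prod_(i < k) f i].

(* A strict chain P_0 < ... < P_n = P of prime ideals, so that the height of P
   is the largest such n. *)
Definition prime_chain P (n : nat) : Prop :=
  exists Q : nat -> set R,
    [/\ forall i, (i <= n)%N -> is_prime_ideal (Q i),
        forall i, (i < n)%N -> Q i `<` Q i.+1
      & Q n = P].

Definition prime_height P (h : nat) : Prop :=
  prime_chain P h /\ forall n, prime_chain P n -> (n <= h)%N.

(* The minimum of the heights of the primes containing I; since chains can be
   truncated, [prime_chain P h] says that P has height at least h (possibly
   infinite). In particular the unit ideal has no height. *)
Definition ideal_height I (h : nat) : Prop :=
  (exists P, [/\ is_prime_ideal P, I `<=` P & prime_height P h]) /\
  (forall P, is_prime_ideal P -> I `<=` P -> prime_chain P h).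

End Ideals.

Section MonomialIdeals.
Variable K : fieldType.
Implicit Types (I : set {mpoly K[2]}) (G H : set 'X_{1..2}).

(* Monomials are identified with their exponent vectors: [m ord0] is the
   exponent of x and [m ord_max] the exponent of y. *)
Definition mon_span G : set {mpoly K[2]} :=
  ideal_span [set 'X_[m] | m in G].

Definition is_monomial_ideal I : Prop := exists G, I = mon_span G.

Definition is_min_mon_gens I G : Prop :=
  I = mon_span G /\ forall H, H `<=` G -> I = mon_span H -> H = G.

End MonomialIdeals.

(* The order on ['X_{1..2}] provided by mpoly is degree-lexicographic, not
   lexicographic. *)
Definition lex_gt (u v : 'X_{1..2}) : bool :=
  (v ord0 < u ord0)%N || (u ord0 == v ord0) && (v ord_max < u ord_max)%N.

Section Convex.
Variable K : fieldType.

(* [s] lists the exponent vectors c_1, ..., c_m of G(I), so [s`_i] is c_(i+1);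
   [0%MM] is only an out-of-range default. *)
Definition is_convex_ideal (I : set {mpoly K[2]}) : Prop :=
  [/\ is_monomial_ideal I,
      ideal_height I 2
    & exists s : seq 'X_{1..2},
        [/\ sorted lex_gt s,
            is_min_mon_gens I [set` s]
          & forall i, (i.+2 < size s)%N ->
              (nth 0 s i.+1 *+ 2 <= nth 0 s i + nth 0 s i.+2)%MM]].

End Convex.

(* Main.v *)
Require Import Defs.
From mathcomp Require Import all_boot all_order all_algebra.
From mathcomp Require Import classical_sets.
From mathcomp Require Import mpoly.
From mathcomp Require Import zify.

(** Let the minimal generators of [I] have exponent vectors [c_0, ..., c_m].
    Since [I] is convex, so is the piecewise linear curve through them, one
    segment per unit of parameter.  [I^k] is generated by the sums
    [c_(i_1) + ... + c_(i_k)], and the idea is to sort these sums by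
    [n = i_1 + ... + i_k], which runs from 0 to [m * k].

    Among the sums with a given [n] there is a least one for the componentwise
    order.  Write [n = q * k + r] with [r < k].  The line through [c_q] and
    [c_(q+1)] supports the curve ([convex_tangent]), so adding up the [k]
    inequalities for the indices [i_t] bounds the sum below by [k] times the
    point of that line at [n / k], which is the vector
    [d_n = (k - r) c_q + r c_(q+1)] ([interp_le_sum]).  This [d_n] is itself a
    sum of [k] generators ([pow_exp_sum]).  Hence the [d_n] generate [I^k]
    ([ideal_pow_pow_exps]).

    The vectors [d_n] inherit everything from the [c_i], because
    [d_(n+1) - d_n = c_(q+1) - c_q] with [q = n %/ k] ([interp_succ]): the
    differences of the new sequence are those of the old one, each repeated [k]
    times.  So the first coordinate still decreases strictly and the second
    still increases strictly, which makes the [d_n] the minimal generators in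
    lexicographic order, and the differences are still nondecreasing, which is
    convexity.

    The height causes no work: a prime contains [I^k] if and only if it
    contains [I] ([prime_ideal_pow]), and the height only depends on the primes
    above the ideal. *)

Set Implicit Arguments.
Unset Strict Implicit.
Unset Printing Implicit Defensive.

Import GRing.Theory.

Local Open Scope classical_set_scope.
Local Open Scope ring_scope.

(** * Spans and powers of ideals *)

Section IdealPowers.
Variable R : comNzRingType.
Implicit Types I J P S : set R.

Lemma ideal_sum I n (f : 'I_n -> R) :
  is_ideal I -> (forall i, I (f i)) -> I (\sum_i f i).
Proof. by case=> I0 ID _ If; elim/big_ind: _. Qed.

Lemma ideal_span_sub S J : is_ideal J -> S `<=` J -> ideal_span S `<=` J.
Proof.
move=> idJ SJ _ [n [c [f [Sf ->]]]]; apply: ideal_sum => // i.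
by case: idJ => _ _; apply; apply: SJ.
Qed.

Lemma sub_ideal_span S : S `<=` ideal_span S.
Proof.
move=> p Sp; exists 1%N, (fun=> 1), (fun=> p); split=> //.
by rewrite big_ord1 mul1r.
Qed.

Lemma ideal_span_ideal S : is_ideal (ideal_span S).
Proof.
split.
- exists 0%N, (fun=> 0), (fun=> 0); rewrite big_ord0.
  by split=> // -[].
- move=> _ _ [n1 [c1 [f1 [S1 ->]]]] [n2 [c2 [f2 [S2 ->]]]].
  pose glue (g1 : 'I_n1 -> R) (g2 : 'I_n2 -> R) i :=
    match split i with inl j => g1 j | inr j => g2 j end.
  exists (n1 + n2)%N, (glue c1 c2), (glue f1 f2); split.
    by move=> i; rewrite /glue; case: (split i).
  rewrite big_split_ord /glue /=; congr (_ + _); apply: eq_bigr => i _.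
    by rewrite -[lshift _ _]/(unsplit (inl i)) unsplitK.
  by rewrite -[rshift _ _]/(unsplit (inr i)) unsplitK.
- move=> p _ [n [c [f [Sf ->]]]]; exists n, (fun i => p * c i), f; split=> //.
  by rewrite mulr_sumr; apply: eq_bigr => i _; rewrite mulrA.
Qed.

Lemma ideal_colon J q : is_ideal J -> is_ideal [set p | J (q * p)].
Proof.
case=> J0 JD JM; split=> /=; first by rewrite mulr0.
  by move=> p p' Jp Jp'; rewrite mulrDr; apply: JD.
by move=> p p' Jp'; rewrite mulrCA; apply: JM.
Qed.

Let products S (k : nat) : set R :=
  [set p | exists f : 'I_k -> R, (forall i, S (f i)) /\ p = \prod_(i < k) f i].

(** Products of sums are expanded one factor at a time: with the other factors
    kept fixed, the admissible values of a factor form an ideal. *)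
Lemma ideal_span_prod S k (f : 'I_k -> R) :
  (forall i, ideal_span S (f i)) ->
  ideal_span (products S k) (\prod_(i < k) f i).
Proof.
elim: k f => [|k IHk] f Sf.
  by apply: sub_ideal_span; exists f; split=> // -[].
rewrite big_ord_recl; set q := (\prod_(i < k) _).
have {IHk} Sq : ideal_span (products S k) q by apply: IHk => i; apply: Sf.
have idT := ideal_span_ideal (products S k.+1).
rewrite mulrC; move: (f ord0) (Sf ord0).
apply: ideal_span_sub; first exact: ideal_colon.
move=> p Sp /=; rewrite mulrC; move: q Sq.
apply: ideal_span_sub; first exact: ideal_colon.
move=> _ [g [Sg ->]] /=; apply: sub_ideal_span.
exists (fun i => if unlift ord0 i is Some j then g j else p); split.
  by move=> i; case: unliftP.
rewrite big_ord_recl unlift_none; congr (_ * _).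
by apply: eq_bigr => i _; rewrite liftK.
Qed.

Lemma ideal_pow_span S k :
  ideal_pow (ideal_span S) k = ideal_span (products S k).
Proof.
apply/seteqP; split; apply: ideal_span_sub; try exact: ideal_span_ideal.
  by move=> _ [f [Sf ->]]; apply: ideal_span_prod.
move=> _ [f [Sf ->]]; apply: sub_ideal_span.
by exists f; split=> // i; apply: sub_ideal_span.
Qed.

Lemma prime_expr P p k : is_prime_ideal P -> P (p ^+ k) -> P p.
Proof.
case=> _ P1 PM; elim: k => [/P1 //|k IHk].
by rewrite exprS => /PM[].
Qed.

Lemma prime_ideal_pow I P k : (0 < k)%N -> is_prime_ideal P ->
  ideal_pow I k `<=` P <-> I `<=` P.
Proof.
move=> k_gt0 primeP; split=> [IkP p Ip|IP].
  apply: (@prime_expr _ _ k) => //; apply/IkP/sub_ideal_span.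
  by exists (fun=> p); split=> //; rewrite prodr_const card_ord.
have [idP _ _] := primeP; apply: ideal_span_sub => // _ [f [If ->]].
case: k k_gt0 f If => // k _ f If; rewrite big_ord_recl mulrC.
by case: idP => _ _; apply; apply: IP.
Qed.

Lemma ideal_height_pow I k h : (0 < k)%N ->
  ideal_height I h -> ideal_height (ideal_pow I k) h.
Proof.
move=> k_gt0 [[P [primeP IP Ph]] hI]; split.
  by exists P; split=> //; apply/prime_ideal_pow.
by move=> Q primeQ /prime_ideal_pow IQ; apply/hI/IQ.
Qed.

End IdealPowers.

(** * Monomial ideals *)

Section Monomials.
Variable K : fieldType.
Implicit Types (G H : set 'X_{1..2}) (s : seq 'X_{1..2}) (u v m : 'X_{1..2}).

Local Notation mon_span := (@mon_span K).

Lemma mon_span_le G H :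
  (forall m, G m -> exists2 h, H h & (h <= m)%MM) -> mon_span G `<=` mon_span H.
Proof.
move=> GH; apply: ideal_span_sub; first exact: ideal_span_ideal.
move=> _ [m /GH[h Hh le_hm] <-]; rewrite -(submK le_hm) mpolyXD.
have [_ _] := ideal_span_ideal [set 'X_[K, m] | m in H]; apply.
by apply: sub_ideal_span; exists h.
Qed.

(** The polynomials all of whose monomials are multiples of elements of [H]
    form an ideal, and it contains the generators of [mon_span H]. *)
Lemma mem_mon_span H m : mon_span H 'X_[m] -> exists2 h, H h & (h <= m)%MM.
Proof.
pose J : set {mpoly K[2]} :=
  [set p | forall u, u \in msupp p -> exists2 h, H h & (h <= u)%MM].
suff HJ : mon_span H `<=` J.
  by move/HJ; apply; rewrite msuppX inE.
apply: ideal_span_sub; first split=> /=.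
- by move=> u; rewrite msupp0.
- move=> p q Jp Jq u /msuppD_le; rewrite mem_cat.
  by case/orP=> [/Jp|/Jq].
- move=> p q Jq u /msuppM_le /allpairsP[[u1 u2] /= [_ /Jq[h Hh hu2] ->]].
  by exists h => //; apply: (lepm_trans hu2); apply: lem_addl.
move=> _ [h Hh <-] u; rewrite msuppX inE => /eqP->.
by exists h => //; apply: lepm_refl.
Qed.

Lemma ideal_pow_mon_span G k :
  ideal_pow (mon_span G) k =
  mon_span [set (\sum_(i < k) f i)%MM | f in [set f | forall i, G (f i)]].
Proof.
rewrite /mon_span ideal_pow_span; congr ideal_span.
apply/seteqP; split=> p /=.
  case=> f [Gf ->]; have {}Gf i : exists m, G m /\ 'X_[K, m] = f i.
    by have [m] := Gf i; exists m.
  have [g Gg] := boolp.choice Gf.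
  exists (\sum_(i < k) g i)%MM; first by exists g => // i; case: (Gg i).
  by rewrite -mprodXE; apply: eq_bigr => i _; case: (Gg i).
case=> _ [f Gf <-] <-; exists (fun i => 'X_[f i]); rewrite mprodXE.
by split=> // i; exists (f i).
Qed.

Lemma min_gens_antichain (I : set {mpoly K[2]}) G u v :
  is_min_mon_gens I G -> G u -> G v -> (u <= v)%MM -> u = v.
Proof.
move=> [-> minG] Gu Gv le_uv.
have [//|neq_uv] := eqVneq u v.
(* If [u] strictly divides [v], then [v] is a redundant generator. *)
suff: (G `\ v) v by case=> _ /(_ erefl).
rewrite (minG (G `\ v)) //.
apply/seteqP; split; apply: mon_span_le => m.
  have [->|/eqP neq_mv] := eqVneq m v => Gm; last first.
    by exists m => //; apply: lepm_refl.
  by exists u => //; split=> //; apply/eqP.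
by case=> Gm _; exists m => //; apply: lepm_refl.
Qed.

Lemma antichain_min_gens G :
  (forall u v, G u -> G v -> (u <= v)%MM -> u = v) ->
  is_min_mon_gens (mon_span G) G.
Proof.
move=> antiG; split=> // H HG eqGH; apply/seteqP; split=> // m Gm.
have : mon_span H 'X_[m] by rewrite -eqGH; apply: sub_ideal_span; exists m.
by case/mem_mon_span=> h Hh /antiG <- //; apply: HG.
Qed.

(** For a list sorted by [lex_gt], being an antichain for divisibility amounts
    to being sorted by this relation. *)
Definition stair u v : bool :=
  (v ord0 < u ord0)%N && (u ord_max < v ord_max)%N.

Lemma stair_trans : transitive stair.
Proof. by rewrite /stair => v u w; lia. Qed.

Lemma lepm2P u v :
  reflect (u ord0 <= v ord0 /\ u ord_max <= v ord_max)%N (u <= v)%MM.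
Proof.
apply: (iffP mnm_lepP) => [le_uv|[le0 le1] i]; first by split.
case: i => [[|[|//]] lt_i].
  by have -> : Ordinal lt_i = ord0 by apply: val_inj.
by have -> : Ordinal lt_i = ord_max by apply: val_inj.
Qed.

Lemma min_gens_stair (I : set {mpoly K[2]}) s :
  sorted lex_gt s -> is_min_mon_gens I [set` s] -> sorted stair s.
Proof.
move=> /(sortedP 0%MM) lex_s minI; apply/(sortedP 0%MM) => i lt_i.
have:= lex_s i lt_i; set u := nth _ _ i; set v := nth _ _ i.+1 => uv.
have su : u \in s by rewrite mem_nth // ltnW.
have sv : v \in s by rewrite mem_nth.
have nvu : ~ (v <= u)%MM.
  move=> /(min_gens_antichain minI sv su) vu.
  by move: uv; rewrite vu /lex_gt; lia.
apply: contra_notT nvu => nuv; apply/lepm2P.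
by move: uv nuv; rewrite /lex_gt /stair; lia.
Qed.

Lemma stair_lex s : sorted stair s -> sorted lex_gt s.
Proof. by apply: sub_sorted => u v /andP[uv _]; rewrite /lex_gt uv. Qed.

Lemma stair_min_gens s :
  sorted stair s -> is_min_mon_gens (mon_span [set` s]) [set` s].
Proof.
move=> stair_s; apply: antichain_min_gens => u v /= su sv /lepm2P[le0 le1].
have nth_stair := sorted_ltn_nth stair_trans 0%MM stair_s.
move: (nth_index 0%MM su) (nth_index 0%MM sv).
have := index_mem u s; have := index_mem v s; rewrite su sv.
case: (ltngtP (index u s) (index v s)) => [ij|ji|-> _ _ <- //] lt_v lt_u eq_u eq_v.
  have := nth_stair _ _ lt_u lt_v ij; rewrite eq_u eq_v /stair; lia.
have := nth_stair _ _ lt_v lt_u ji; rewrite eq_u eq_v /stair; lia.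
Qed.

End Monomials.

(** * Convex sequences of natural numbers *)

Section ConvexSequences.
Variables (a : nat -> nat) (L : nat).
Local Open Scope nat_scope.

Definition convex_seq := forall i, i.+2 < L -> a i.+1 * 2 <= a i + a i.+2.

Lemma convex_slope i j : convex_seq -> i <= j -> j.+1 < L ->
  a i.+1 + a j <= a i + a j.+1.
Proof.
move=> cvx /subnKC <-; elim: (j - i) => [|t IHt] lt_L; first by rewrite addn0 addnC.
rewrite addnS in lt_L *.
by have := cvx _ lt_L; have := IHt (ltnW lt_L); lia.
Qed.

(** This is [a q + (i - q) * (a q.+1 - a q) <= a i], for [i] on either side of
    [q], with the negative terms moved across. *)
Lemma convex_tangent q i : convex_seq -> q.+1 < L -> i < L ->
  a q + i * a q.+1 + q * a q <= a i + i * a q + q * a q.+1.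
Proof.
move=> cvx lt_q lt_i; have [le_qi|/ltnW le_iq] := leqP q i.
  rewrite -(subnKC le_qi) in lt_i *.
  elim: (i - q) lt_i => [|t IHt] lt_i; first by rewrite addn0; lia.
  rewrite addnS in lt_i *; have := IHt (ltnW lt_i).
  by have := convex_slope cvx (leq_addr t q) lt_i; lia.
have := leq_subr i q; rewrite -{2 3 4}(subKn le_iq).
elim: (q - i) => [|t IHt] le_t; first by rewrite subn0; lia.
have := IHt (ltnW le_t).
have := @convex_slope (q - t.+1) q cvx (leq_subr _ _) lt_q.
by have -> : q - t = (q - t.+1).+1 by [lia]; lia.
Qed.

(** [k] times the value at [n / k] of the piecewise linear function through the
    points [(i, a i)]. *)
Definition interp k n := a (n %/ k) * (k - n %% k) + a (n %/ k).+1 * (n %% k).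

Lemma interp_succ k n : 0 < k ->
  interp k n.+1 + a (n %/ k) = interp k n + a (n %/ k).+1.
Proof.
move=> k_gt0; rewrite /interp.
have lt_r := ltn_pmod n k_gt0; have nE := divn_eq n k.
move: (n %/ k) (n %% k) lt_r nE => q r lt_r ->.
have [lt_r1|le_r1] := ltnP r.+1 k.
  rewrite -addnS divnMDl // modnMDl divn_small // modn_small // addn0.
  have -> : k - r = (k - r.+1).+1 by lia.
  lia.
have -> : (q * k + r).+1 = q.+1 * k by lia.
rewrite mulnK // modnMl; have -> : k = r.+1 by lia.
by rewrite subSnn; lia.
Qed.

Lemma interp_le_sum k (f : 'I_k -> nat) : 0 < k -> convex_seq ->
  (forall t, f t < L) -> interp k (\sum_(t < k) f t) <= \sum_(t < k) a (f t).
Proof.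
move=> k_gt0 cvx lt_f; set n := \sum_(t < k) f t.
have lt_r := ltn_pmod n k_gt0; have nE := divn_eq n k.
rewrite /interp; move: (n %/ k) (n %% k) lt_r nE => q r lt_r nE.
have [lt_q|le_q] := ltnP q.+1 L.
  have : \sum_(t < k) (a q + f t * a q.+1 + q * a q) <=
         \sum_(t < k) (a (f t) + f t * a q + q * a q.+1).
    by apply: leq_sum => t _; apply: convex_tangent.
  rewrite !big_split /= -!big_distrl /= -/n !sum_nat_const card_ord nE.
  nia.
(* The tangent at the last index has no second point to pass through, but
   then every [f t] is that last index. *)
have le_f t : f t <= L.-1 by have := lt_f t; lia.
have [_ eq_sum] := leqif_sum (P := xpredT) (fun t _ => leqif_eq (le_f t)).
have /forall_inP eq_f : [forall (t | true), f t == L.-1].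
  rewrite -eq_sum eqn_leq leq_sum //=.
  rewrite sum_nat_const card_ord -/n nE.
  have : k * L.-1 <= k * q by rewrite leq_mul2l; apply/orP; right; lia.
  lia.
have {}eq_f t : f t = L.-1 by apply/eqP/eq_f.
move: nE; rewrite /n; under eq_bigr do rewrite eq_f.
under [X in _ -> _ <= X]eq_bigr do rewrite eq_f.
rewrite !sum_nat_const card_ord => nE.
have -> : q = L.-1.
  apply/eqP; rewrite eqn_leq; apply/andP; split; last by lia.
  by rewrite -(leq_pmul2l k_gt0); lia.
have -> : r = 0 by nia.
by lia.
Qed.

Lemma interp_convex k n : 0 < k -> convex_seq -> n.+2 + k.-1 < L * k ->
  interp k n.+1 * 2 <= interp k n + interp k n.+2.
Proof.
move=> k_gt0 cvx lt_n.
have := interp_succ n k_gt0; have := interp_succ n.+1 k_gt0.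
have le_q : n %/ k <= n.+1 %/ k by apply: leq_div2r.
have lt_q : (n.+1 %/ k).+1 < L.
  rewrite -[_.+1 < L]ltn_predRL ltn_divLR //.
  by move: lt_n; case: (L) => [|l]; rewrite ?mulSn /=; lia.
have := convex_slope cvx le_q lt_q; lia.
Qed.

End ConvexSequences.

(** * Generators of the power *)

Section PowerGenerators.
Variables (s : seq 'X_{1..2}) (k : nat).

Local Notation coord i := (fun j => nth 0%MM s j i).

Definition pow_exp n : 'X_{1..2} :=
  (nth 0 s (n %/ k)%N *+ (k - n %% k)%N + nth 0 s (n %/ k).+1 *+ (n %% k)%N)%MM.

(** If [s] is not empty there are [(size s).-1 * k + 1] of these; written as
    below, the length is also right, namely 0, when [s] is empty. *)
Definition pow_exps : seq 'X_{1..2} := mkseq pow_exp (size s * k - k.-1).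

Lemma pow_expE n i : pow_exp n i = interp (coord i) k n.
Proof. by rewrite mnmDE !mulmnE. Qed.

Lemma ltn_size_pow_exps n :
  (n < size pow_exps)%N = (n + k.-1 < size s * k)%N.
Proof. by rewrite size_mkseq; lia. Qed.

Lemma nth_pow_exps n :
  (n < size pow_exps)%N -> nth 0%MM pow_exps n = pow_exp n.
Proof. by rewrite size_mkseq => lt_n; rewrite nth_mkseq. Qed.

(** [d_n] is the sum of [k - r] copies of [c_q] and [r] copies of [c_(q+1)],
    where [n = q * k + r]; at the last [n] the vector [c_(q+1)] does not
    exist, but then [r = 0]. *)
Lemma pow_exp_sum n : (0 < k)%N -> (n < size pow_exps)%N ->
  exists2 f : 'I_k -> 'X_{1..2},
    forall t, f t \in s & pow_exp n = (\sum_(t < k) f t)%MM.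
Proof.
rewrite ltn_size_pow_exps => k_gt0 lt_n.
have lt_r := ltn_pmod n k_gt0; have nE := divn_eq n k.
rewrite /pow_exp; move: (n %/ k)%N (n %% k)%N lt_r nE => q r lt_r nE.
exists (fun t : 'I_k => nth 0%MM s (if (t < r)%N then q.+1 else q)).
  move=> t; have lt_q : (q < size s)%N by rewrite -(ltn_pmul2r k_gt0); lia.
  have lt_q1 : (0 < r -> q.+1 < size s)%N.
    by move=> r_gt0; rewrite -(ltn_pmul2r k_gt0) mulSn; lia.
  by case: ifP => lt_t; apply: mem_nth => //; apply: lt_q1; apply: leq_trans lt_t.
apply/mnmP => i; rewrite mnmDE !mulmnE mnm_sumE.
rewrite -(big_mkord xpredT (fun t => nth 0%MM s (if (t < r)%N then q.+1 else q) i)).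
rewrite (big_cat_nat (leq0n r) (ltnW lt_r)) [RHS]addnC; congr (_ + _)%N.
  rewrite (@eq_big_nat _ _ _ _ _ _ (fun=> nth 0%MM s q i)).
    by rewrite sum_nat_const_nat mulnC.
  by move=> t /andP[le_t _]; rewrite ltnNge le_t.
rewrite (@eq_big_nat _ _ _ _ _ _ (fun=> nth 0%MM s q.+1 i)).
  by rewrite sum_nat_const_nat subn0 mulnC.
by move=> t /andP[_ ->].
Qed.

Lemma pow_exp_le_sum (f : 'I_k -> nat) : (0 < k)%N ->
    (forall i, convex_seq (coord i) (size s)) ->
    (forall t, (f t < size s)%N) ->
  (pow_exp (\sum_(t < k) f t) <= \sum_(t < k) nth 0 s (f t))%MM.
Proof.
move=> k_gt0 cvx lt_f; apply/mnm_lepP => i.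
by rewrite pow_expE mnm_sumE; apply: (interp_le_sum k_gt0 (cvx i)).
Qed.

Lemma ideal_pow_pow_exps (K : fieldType) : (0 < k)%N ->
    (forall i, convex_seq (coord i) (size s)) ->
  ideal_pow (@mon_span K [set` s]) k = @mon_span K [set` pow_exps].
Proof.
move=> k_gt0 cvx; rewrite ideal_pow_mon_span.
apply/seteqP; split; apply: mon_span_le => m /=.
  case=> f sf <-; pose g t := index (f t) s.
  have lt_g t : (g t < size s)%N by rewrite index_mem; apply: sf.
  exists (pow_exp (\sum_(t < k) g t)).
    suff lt_n : (\sum_(t < k) g t < size pow_exps)%N.
      by rewrite -(nth_pow_exps lt_n) mem_nth.
    rewrite ltn_size_pow_exps.
    have : (\sum_(t < k) g t <= \sum_(t < k) (size s).-1)%N.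
      by apply: leq_sum => t _; have := lt_g t; lia.
    have := lt_g (Ordinal k_gt0); rewrite sum_nat_const card_ord.
    by case: (size s) => //= l _; rewrite mulSn mulnC; lia.
  apply: (lepm_trans (pow_exp_le_sum k_gt0 cvx lt_g)).
  rewrite [X in (X <= _)%MM](_ : _ = \sum_(t < k) f t)%MM ?lepm_refl //.
  by apply: eq_bigr => t _; rewrite nth_index //; apply: sf.
case/(nthP 0%MM) => n lt_n <-; have [f sf fE] := pow_exp_sum k_gt0 lt_n.
rewrite nth_pow_exps // fE.
by exists (\sum_(t < k) f t)%MM; [exists f | apply: lepm_refl].
Qed.

Lemma pow_exps_stair : (0 < k)%N -> sorted stair s -> sorted stair pow_exps.
Proof.
move=> k_gt0 /(sortedP 0%MM) stair_s; apply/(sortedP 0%MM) => n lt_n.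
rewrite !nth_pow_exps ?(ltnW lt_n) // /stair !pow_expE.
have := interp_succ (coord ord0) n k_gt0.
have := interp_succ (coord ord_max) n k_gt0.
have lt_q : ((n %/ k).+1 < size s)%N.
  rewrite ltn_size_pow_exps in lt_n; rewrite -ltn_predRL ltn_divLR //.
  by move: lt_n; case: (size s) => [|l]; rewrite ?mulSn /=; lia.
by have := stair_s _ lt_q; rewrite /stair; lia.
Qed.

Lemma pow_exps_convex i : (0 < k)%N -> convex_seq (coord i) (size s) ->
  convex_seq (fun n => nth 0%MM pow_exps n i) (size pow_exps).
Proof.
move=> k_gt0 cvx n lt_n.
rewrite !nth_pow_exps ?(ltnW lt_n) ?(ltnW (ltnW lt_n)) //.
rewrite !pow_expE; apply: interp_convex cvx _ => //.
by rewrite -ltn_size_pow_exps.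
Qed.

End PowerGenerators.

Lemma convex_expsP (s : seq 'X_{1..2}) :
  (forall i, (i.+2 < size s)%N ->
     (nth 0 s i.+1 *+ 2 <= nth 0 s i + nth 0 s i.+2)%MM) <->
  (forall j, convex_seq (fun i => nth 0%MM s i j) (size s)).
Proof.
split=> [cvx j i /cvx/mnm_lepP/(_ j)|cvx i lt_i].
  by rewrite mulmnE mnmDE.
by apply/mnm_lepP => j; rewrite mulmnE mnmDE; apply: cvx.
Qed.

Theorem proposition2p8 (K : fieldType) (I : set {mpoly K[2]}) :
  is_convex_ideal I -> forall k : nat, (1 <= k)%N -> is_convex_ideal (ideal_pow I k).
Proof.
case=> _ htI [s [lex_s minI /convex_expsP cvx]] k k_gt0.
have stair_s := min_gens_stair lex_s minI.
have powE : ideal_pow I k = @mon_span K [set` pow_exps s k].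
  by case: minI => -> _; apply: ideal_pow_pow_exps.
have stair_d := pow_exps_stair k_gt0 stair_s.
split; first by exists [set` pow_exps s k].
  exact: ideal_height_pow.
exists (pow_exps s k); split; first exact: stair_lex.
  by rewrite powE; apply: stair_min_gens.
by apply/convex_expsP => j; apply: pow_exps_convex.
Qed.
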